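(* Let $k$ be a differential field of characteristic zero with an algebraically closed field of constants $C$ and let $\bar{k}$ be an algebraic closure of $k$, with the extended derivation. Let $f\in\bar{k}[Y,Z]$ be an irreducible polynomial having the following properties: (a) $p:=(0,0)$ is a simple point of the plane curve $f=0$ and $Z$ is the tangent line at $p$ (i.e. the tangent line to $f=0$ at $p$ is the line $Z=0$). (b) With respect to the uniformizing parameter $Y$ at $p$, both of the coefficients $\lambda_2$ and $\lambda_3$ of the $Y$-adic expansion $Z=\lambda_2Y^2+\lambda_3Y^3+\cdots$ on the curve (with $\lambda_i\in\bar k$) have no antiderivative in $\bar{k}$; that is, for $i=2,3$ there is no $\eta\in\bar k$ with $\eta'=\lambda_i$. Then the differential equation $f(y,y')=0$ (over $\bar k$) is of general type.
   Context: The following definitions are applied with base differential field $F=\bar k$, whose field of constants is $C$. For an irreducible $f\in F[Y,Z]$ involving $Z$, $F(f)$ denotes the field of fractions of $F[Y,Z]/\langle f\rangle$, with the derivation induced by $f$: it extends that of $F$ and maps $y$ to $z$, where $y,z$ are the images of $Y,Z$. A solution of $f(y,y')=0$ is an element $u$ of a differential field extension of $F$ having $C$ as its field of constants such that $f(u,u')=0$; it is nonalgebraic if it is not algebraic over $F$. For a finite algebraic extension $\tilde F$ of $F$, $\tilde F(f)$ denotes the compositum of $\tilde F$ and $F(f)$ (for $F=\bar k$ algebraically closed, $\tilde F=F$). The equation $f(y,y')=0$ over $F$ is of: - algebraic type if all solutions of $f(y,y')=0$ are algebraic over $F$, or equivalently, $F(f)$ with the induced derivation has a constant not algebraic over $F$;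 - Riccati type if there are a nonalgebraic solution of $f(y,y')=0$, a finite algebraic extension $\tilde F$ of $F$ and an element $t\in\tilde F(f)$ such that $\tilde F(f)$ is a finite algebraic extension of $\tilde F(t)$ and $t'=a_2t^2+a_1t+a_0$ with $a_0,a_1,a_2\in\tilde F$ not all zero; - Weierstrass type if there are a nonalgebraic solution of $f(y,y')=0$, a finite algebraic extension $\tilde F$ of $F$ and an element $t\in\tilde F(f)$ such that $\tilde F(f)$ is a finite algebraic extension of $\tilde F(t,t')$ and $(t')^2=\alpha^2(4t^3-g_2t-g_3)$ with $g_2,g_3\in C$, $\alpha\in\tilde F$ and $27g_3^2-g_2^3\neq0$; - general type if it is not of algebraic, Riccati or Weierstrass type. *)

(* Defs.v *)
From HB Require Import structures.
From mathcomp Require Import all_boot all_order all_algebra all_field.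
From mathcomp Require Import classical_sets.

Set Implicit Arguments.
Unset Strict Implicit.
Unset Printing Implicit Defensive.

Import GRing.Theory.
Local Open Scope classical_set_scope.
Local Open Scope ring_scope.

(* A differential field is a fieldType together with a map satisfying           *)
(* [derivation]; F[Y,Z] is {poly {poly F}}, where the inner variable 'X%:P is Y *)
(* and the outer variable 'X is Z.                                              *)

Definition derivation (R : fieldType) (d : R -> R) : Prop :=
  (forall x y, d (x + y) = d x + d y) /\
  (forall x y, d (x * y) = d x * y + x * d y).

Definition diff_ext (F L : fieldType) (dF : F -> F) (dL : L -> L)
    (j : {rmorphism F -> L}) : Prop :=
  derivation dL /\ (forall x, dL (j x) = j (dF x)).

Definition closed_constants (F : fieldType) (d : F -> F) : Prop :=
  forall p : {poly F}, (forall i, d p`_i = 0) -> (1 < size p)%N ->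
  exists2 c, d c = 0 & root p c.

Definition has_antiderivative (F : fieldType) (d : F -> F) (a : F) : Prop :=
  exists eta, d eta = a.

(** Subfields *)

Definition subfield_set (E : fieldType) (S : set E) : Prop :=
  [/\ S 1, (forall x y, S x -> S y -> S (x - y))
    & (forall x y, S x -> S y -> S (x / y))].

Definition gen_subfield (E : fieldType) (A : set E) : set E :=
  smallest (@subfield_set E) A.

(* E is a finite extension of its subfield S *)
Definition finite_over (E : fieldType) (S : set E) : Prop :=
  exists s : seq E, forall x : E, exists2 c : nat -> E,
    (forall i, S (c i)) & x = \sum_(i < size s) c i * s`_i.

(** Plane curves *)

Section PlaneCurves.
Variable F : fieldType.
Implicit Types f g : {poly {poly F}}.

(* Irreducibility in the ring F[Y,Z]; the library's [irreducible_poly] is about *)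
(* pseudo-division and would ignore factors in F[Y].                            *)
Definition irreducible_biv f : Prop :=
  [/\ f != 0, f \isn't a GRing.unit
    & forall g h, f = g * h -> (g \is a GRing.unit) || (h \is a GRing.unit)].

(* g(y,z), the coefficients of g being mapped to K by i *)
Definition eval_ext (K : fieldType) (i : {rmorphism F -> K}) g (y z : K) : K :=
  (map_poly (map_poly i) g).[z%:P].[y].

Definition eval_biv g (y z : F) : F := g.[z%:P].[y].

Definition partialY g : {poly {poly F}} := map_poly (@deriv F) g.
Definition partialZ g : {poly {poly F}} := g^`().

Definition simple_point f (P : F * F) : Prop :=
  eval_biv f P.1 P.2 = 0 /\
  (eval_biv (partialY f) P.1 P.2 != 0 \/ eval_biv (partialZ f) P.1 P.2 != 0).

Definition tangent_line f (P : F * F) : set (F * F) :=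
  [set Q | eval_biv (partialY f) P.1 P.2 * (Q.1 - P.1)
           + eval_biv (partialZ f) P.1 P.2 * (Q.2 - P.2) = 0].

(* [lam] is the Y-adic expansion of the polynomial function u at the origin of  *)
(* f = 0: for every n, u - \sum_(i <= n) lam_i Y^i lies in Y^(n+1) O_p, where   *)
(* O_p is the local ring of the curve at p = (0,0), i.e. the localization of    *)
(* F[Y,Z]/<f> at the classes of the polynomials s with s(0,0) != 0.             *)
Definition Yadic_expansion f (u : {poly {poly F}}) (lam : nat -> F) : Prop :=
  forall n : nat, exists s g h : {poly {poly F}},
    eval_biv s 0 0 != 0 /\
    s * (u - (\poly_(i < n.+1) lam i)%:P) = g * 'X%:P ^+ n.+1 + h * f.

End PlaneCurves.

(** Differential equations f(y,y') = 0 over the differential field (F, dF) *)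

Section Types.
Variables (F : fieldType) (dF : F -> F) (f : {poly {poly F}}).

Definition is_solution (L : fieldType) (dL : L -> L) (j : {rmorphism F -> L})
    (u : L) : Prop :=
  [/\ diff_ext dF dL j,
      (forall c, dL c = 0 -> exists2 a, dF a = 0 & c = j a)
    & eval_ext j f u (dL u) = 0].

Definition has_nonalgebraic_solution : Prop :=
  exists (L : fieldType) (dL : L -> L) (j : {rmorphism F -> L}) (u : L),
    is_solution dL j u /\ ~ algebraicOver j u.

(* (K, dK, i) is F(f) with its induced derivation, y and z being the images of  *)
(* Y and Z. The third and fourth conditions are the universal characterization  *)
(* of the fraction field of F[Y,Z]/<f>; for f irreducible involving Z such a K  *)
(* exists and is unique up to isomorphism.                                      *)
Definition is_function_field (K : fieldType) (dK : K -> K)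
    (i : {rmorphism F -> K}) (y z : K) : Prop :=
  [/\ diff_ext dF dK i,
      dK y = z,
      (forall g, eval_ext i g y z = 0 <-> exists h, g = h * f)
    & (forall x, exists g h,
         eval_ext i h y z != 0 /\ x = eval_ext i g y z / eval_ext i h y z)].

(* (E, dE) is a compositum of the finite extension Ft of F (a differential      *)
(* extension through the structure map in_alg) with F(f)                        *)
Definition is_compositum (Ft : fieldExtType F) (E : fieldType) (dE : E -> E)
    (jt : {rmorphism Ft -> E}) : Prop :=
  exists (dT : Ft -> Ft) (K : fieldType) (dK : K -> K)
         (i : {rmorphism F -> K}) (y z : K) (jK : {rmorphism K -> E}),
    [/\ is_function_field dK i y z,
        diff_ext dF dT (in_alg Ft),
        diff_ext dT dE jt /\ diff_ext dK dE jK,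
        (forall a : F, jt a%:A = jK (i a))
      & gen_subfield (range jt `|` range jK) = setT].

Definition algebraic_type : Prop :=
  forall (L : fieldType) (dL : L -> L) (j : {rmorphism F -> L}) (u : L),
    is_solution dL j u -> algebraicOver j u.

Definition Riccati_type : Prop :=
  has_nonalgebraic_solution /\
  exists (Ft : fieldExtType F) (E : fieldType) (dE : E -> E)
         (jt : {rmorphism Ft -> E}) (t : E) (a0 a1 a2 : Ft),
    [/\ is_compositum dE jt,
        finite_over (gen_subfield (range jt `|` [set t])),
        dE t = jt a2 * t ^+ 2 + jt a1 * t + jt a0
      & ~~ [&& a0 == 0, a1 == 0 & a2 == 0]].

Definition Weierstrass_type : Prop :=
  has_nonalgebraic_solution /\
  exists (Ft : fieldExtType F) (E : fieldType) (dE : E -> E)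
         (jt : {rmorphism Ft -> E}) (t : E) (g2 g3 : F) (alpha : Ft),
    [/\ is_compositum dE jt,
        finite_over (gen_subfield (range jt `|` [set t; dE t])),
        dF g2 = 0 /\ dF g3 = 0,
        dE t ^+ 2 = jt alpha ^+ 2 * (4%:R * t ^+ 3 - jt g2%:A * t - jt g3%:A)
      & 27%:R * g3 ^+ 2 - g2 ^+ 3 != 0].

Definition general_type : Prop :=
  [/\ ~ algebraic_type, ~ Riccati_type & ~ Weierstrass_type].

End Types.

(* Main.v *)
(**
With z = lam_2 Y^2 + lam_3 Y^3 + ..., the pair (Y, z) is a point of f = 0 with
coordinates in F[[Y]], and the function field F(f) embeds, as a differential
field, in the fraction field L of F[[Y]] with the derivation extending that of
F by Y' = z.  As Y' is in Y^2 F[[Y]], the derivative of Y^n (c + e Y + ...) is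
Y^n (c' + (e' + n lam_2 c) Y + ...).

For a nonconstant solution t = t_0 + c Y^n + e Y^(n+1) + g Y^(n+2) + ... in L,
or its inverse if t has a pole, comparing the first coefficients of
t' = a_2 t^2 + a_1 t + a_0 gives (e/c)' = - n lam_2 if n > 1, and
(e^2/c^2 - g/c)' = lam_3 if n = 1.  So a solution of a Riccati equation in L
lies in F.  In particular, the constants of L are in F, whence Y is a
nonalgebraic solution.

For a solution of (t')^2 = alpha^2 (4 t^3 - g_2 t - g_3) a pole is impossible
by comparing orders.  Otherwise the elliptic integral of dx/sqrt(P(x)) from t_0
to t is a constant, P being the cubic polynomial; its first coefficients again
express lam_2 as a derivative.
*)
Require Import Defs.
From HB Require Import structures.
From mathcomp Require Import all_boot all_order all_algebra all_field.
From mathcomp Require Import classical_sets.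
From mathcomp Require Import boolp ring.

Set Implicit Arguments.
Unset Strict Implicit.
Unset Printing Implicit Defensive.

Import GRing.Theory.
Local Open Scope classical_set_scope.
Local Open Scope ring_scope.

(** * Formal power series *)

Record fps (F : Type) : Type := Fps { fcoef : nat -> F }.
Arguments Fps {F}.

Section FpsRing.
Variable F : fieldType.
Implicit Types a b c : fps F.

Lemma fps_eqP a b : (forall n, fcoef a n = fcoef b n) -> a = b.
Proof. by case: a b => [a] [b] /= ab; congr Fps; apply/funext. Qed.

HB.instance Definition _ := gen_eqMixin (fps F).
HB.instance Definition _ := gen_choiceMixin (fps F).

Definition fps_cst (x : F) := Fps (fun n => if n is 0 then x else 0).
Definition fps_add a b := Fps (fun n => fcoef a n + fcoef b n).
Definition fps_opp a := Fps (fun n => - fcoef a n).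
Definition fps_mul a b :=
  Fps (fun n => \sum_(i < n.+1) fcoef a i * fcoef b (n - i)).

Fact fps_addA : associative fps_add.
Proof. by move=> a b c; apply: fps_eqP => n /=; rewrite addrA. Qed.
Fact fps_addC : commutative fps_add.
Proof. by move=> a b; apply: fps_eqP => n /=; rewrite addrC. Qed.
Fact fps_add0 : left_id (fps_cst 0) fps_add.
Proof. by move=> a; apply: fps_eqP => -[|n] /=; rewrite add0r. Qed.
Fact fps_addN : left_inverse (fps_cst 0) fps_opp fps_add.
Proof. by move=> a; apply: fps_eqP => -[|n] /=; rewrite addNr. Qed.

HB.instance Definition _ :=
  GRing.isZmodule.Build (fps F) fps_addA fps_addC fps_add0 fps_addN.

Definition fps_trunc N a : {poly F} := \poly_(i < N) fcoef a i.

(** The n-th coefficient of a product involves only coefficients of index at most n, so identities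
    between products of series are inherited from truncations in [{poly F}]. *)
Lemma coef_fps_mul_poly a b (p q : {poly F}) n :
  (forall i, (i <= n)%N -> fcoef a i = p`_i) ->
  (forall i, (i <= n)%N -> fcoef b i = q`_i) ->
  fcoef (fps_mul a b) n = (p * q)`_n.
Proof.
move=> ap bq; rewrite coefM; apply: eq_bigr => -[i /= i_n] _.
by rewrite ap // bq // leq_subr.
Qed.

Lemma coef_fps_trunc N a i : (i < N)%N -> fcoef a i = (fps_trunc N a)`_i.
Proof. by move=> iN; rewrite coef_poly iN. Qed.

Lemma coef_fps_mul_trunc N a b n : (n < N)%N ->
  fcoef (fps_mul a b) n = (fps_trunc N a * fps_trunc N b)`_n.
Proof.
by move=> nN; apply: coef_fps_mul_poly => i i_n;
  apply: coef_fps_trunc; apply: leq_ltn_trans nN.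
Qed.

Lemma coef_fps_mul3 a b c n :
  fcoef (fps_mul a (fps_mul b c)) n =
  (fps_trunc n.+1 a * (fps_trunc n.+1 b * fps_trunc n.+1 c))`_n.
Proof.
rewrite coefM; apply: eq_bigr => -[i /= iN] _.
by rewrite coef_poly iN -coef_fps_mul_trunc // ltnS leq_subr.
Qed.

Fact fps_mulC : commutative fps_mul.
Proof.
move=> a b; apply: fps_eqP => n.
by rewrite !(@coef_fps_mul_trunc n.+1) // mulrC.
Qed.
Fact fps_mulA : associative fps_mul.
Proof.
move=> a b c; apply: fps_eqP => n.
rewrite coef_fps_mul3 (fps_mulC _ c) coef_fps_mul3.
by rewrite mulrA [in RHS]mulrC.
Qed.
Fact fps_mul1 : left_id (fps_cst 1) fps_mul.
Proof.
move=> a; apply: fps_eqP => n /=.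
rewrite big_ord_recl /= mul1r subn0 big1 ?addr0 // => i _.
by rewrite mul0r.
Qed.
Fact fps_mulD : left_distributive fps_mul fps_add.
Proof.
move=> a b c; apply: fps_eqP => n /=.
by rewrite -big_split; apply: eq_bigr => i _; rewrite /= mulrDl.
Qed.
Fact fps_neq0 : fps_cst 1 != 0.
Proof.
by apply/eqP => /(congr1 (fun a => fcoef a 0)) /eqP; rewrite oner_eq0.
Qed.

HB.instance Definition _ := GRing.Zmodule_isComNzRing.Build (fps F)
  fps_mulA fps_mulC fps_mul1 fps_mulD fps_neq0.

Lemma fcoefD a b n : fcoef (a + b) n = fcoef a n + fcoef b n.
Proof. by []. Qed.
Lemma fcoefB a b n : fcoef (a - b) n = fcoef a n - fcoef b n.
Proof. by []. Qed.
Lemma fcoefM a b n :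
  fcoef (a * b) n = \sum_(i < n.+1) fcoef a i * fcoef b (n - i).
Proof. by []. Qed.
Lemma fcoef0 n : fcoef (0 : fps F) n = 0.
Proof. by case: n. Qed.

Lemma fcoefM_0 a b : fcoef (a * b) 0 = fcoef a 0 * fcoef b 0.
Proof. by rewrite fcoefM big_ord_recr big_ord0 /= add0r. Qed.
Lemma fcoefM_1 a b :
  fcoef (a * b) 1 = fcoef a 0 * fcoef b 1 + fcoef a 1 * fcoef b 0.
Proof. by rewrite fcoefM !big_ord_recr big_ord0 /= add0r. Qed.
Lemma fcoefM_2 a b :
  fcoef (a * b) 2 =
  fcoef a 0 * fcoef b 2 + fcoef a 1 * fcoef b 1 + fcoef a 2 * fcoef b 0.
Proof. by rewrite fcoefM !big_ord_recr big_ord0 /= add0r. Qed.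

Definition fcoef_at0 a := fcoef a 0.

Fact fcoef_at0_is_zmod_morphism : zmod_morphism fcoef_at0.
Proof. by []. Qed.
HB.instance Definition _ :=
  GRing.isZmodMorphism.Build (fps F) F fcoef_at0 fcoef_at0_is_zmod_morphism.
Fact fcoef_at0_is_monoid_morphism : monoid_morphism fcoef_at0.
Proof. by split=> // a b; exact: fcoefM_0. Qed.
HB.instance Definition _ :=
  GRing.isMonoidMorphism.Build (fps F) F fcoef_at0 fcoef_at0_is_monoid_morphism.

Lemma fcoef_cstM x a n : fcoef (fps_cst x * a) n = x * fcoef a n.
Proof.
rewrite fcoefM big_ord_recl /= subn0 big1 ?addr0 // => i _.
by rewrite mul0r.
Qed.

Fact fps_cst_is_zmod_morphism : zmod_morphism fps_cst.
Proof. by move=> x y; apply: fps_eqP => -[|n]; rewrite fcoefB //= subr0. Qed.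
HB.instance Definition _ :=
  GRing.isZmodMorphism.Build F (fps F) fps_cst fps_cst_is_zmod_morphism.
Fact fps_cst_is_monoid_morphism : monoid_morphism fps_cst.
Proof.
by split=> // x y; apply: fps_eqP => -[|n]; rewrite fcoef_cstM //= mulr0.
Qed.
HB.instance Definition _ :=
  GRing.isMonoidMorphism.Build F (fps F) fps_cst fps_cst_is_monoid_morphism.

(** Course-of-values recursion: the coefficient b_m of the inverse is solved from sum_(i <= m) b_i
    a_(m-i) = [m = 0], so all the earlier ones are kept in a list. *)
Fixpoint fps_inv_prefix a n : seq F :=
  if n is m.+1 then
    let s := fps_inv_prefix a m in
    rcons s (((m == 0)%:R - \sum_(i < m) s`_i * fcoef a (m - i)) / fcoef a 0)
  else [::].

Definition fps_unit : pred (fps F) := fun a => fcoef a 0 != 0.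
Definition fps_inv a :=
  if fps_unit a then Fps (fun n => (fps_inv_prefix a n.+1)`_n) else a.

Lemma size_fps_inv_prefix a n : size (fps_inv_prefix a n) = n.
Proof. by elim: n => //= n IH; rewrite size_rcons IH. Qed.

Lemma nth_fps_inv_prefix a n i : (i < n)%N ->
  (fps_inv_prefix a n)`_i = (fps_inv_prefix a i.+1)`_i.
Proof.
elim: n => // n IH; rewrite ltnS leq_eqVlt => /orP[/eqP->//|lt_in].
by rewrite [fps_inv_prefix a n.+1]/= nth_rcons size_fps_inv_prefix lt_in IH.
Qed.

Fact fps_mulVx : {in fps_unit, left_inverse 1 fps_inv *%R}.
Proof.
move=> a ua; rewrite /fps_inv ifT //; move: ua; rewrite unfold_in => ua.
apply: fps_eqP => n; rewrite fcoefM big_ord_recr subnn /=.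
rewrite nth_rcons size_fps_inv_prefix ltnn eqxx divfK // addrC.
rewrite [X in _ - X](eq_bigr
  (fun i : 'I_n => (fps_inv_prefix a i.+1)`_i * fcoef a (n - i))) => [|i _].
  by rewrite subrK; case: n.
by rewrite nth_fps_inv_prefix.
Qed.
Fact fps_unitPl a b : b * a = 1 -> fps_unit a.
Proof.
move=> /(congr1 (fun c => fcoef c 0)); rewrite fcoefM_0 => /eqP ba1.
by apply/negP => /eqP a0; move: ba1; rewrite a0 mulr0 eq_sym oner_eq0.
Qed.
Fact fps_inv_out : {in [predC fps_unit], fps_inv =1 id}.
Proof. by move=> a /negbTE ua; rewrite /fps_inv ifF. Qed.

HB.instance Definition _ := GRing.ComNzRing_hasMulInverse.Build (fps F)
  fps_mulVx fps_unitPl fps_inv_out.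

Definition fpsX : fps F := Fps (fun n => (n == 1)%:R).

Lemma fcoef_XnM n a k :
  fcoef (fpsX ^+ n * a) k = if (k < n)%N then 0 else fcoef a (k - n).
Proof.
elim: n k => [|n IH] k; first by rewrite mul1r subn0.
rewrite exprS -mulrA; case: k => [|k]; first by rewrite fcoefM_0 /= mul0r.
rewrite fcoefM big_ord_recl mul0r add0r big_ord_recl mul1r subn1 IH ltnS.
by rewrite big1 ?addr0 // => i _; rewrite mul0r.
Qed.

Lemma fcoef_Xn_lt n a k : (k < n)%N -> fcoef (fpsX ^+ n * a) k = 0.
Proof. by rewrite fcoef_XnM => ->. Qed.

Lemma fcoef_Xn_ge n a k : fcoef (fpsX ^+ n * a) (n + k) = fcoef a k.
Proof. by rewrite fcoef_XnM ltnNge leq_addr addnC addnK. Qed.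

Lemma fpsX_divides n a : (forall k, (k < n)%N -> fcoef a k = 0) ->
  a = fpsX ^+ n * Fps (fun k => fcoef a (n + k)).
Proof.
move=> a0; apply: fps_eqP => k; rewrite fcoef_XnM.
by case: ltnP => [/a0//|nk]; rewrite /= subnKC.
Qed.

Lemma fps_order a : a != 0 -> exists n q, fcoef q 0 != 0 /\ a = fpsX ^+ n * q.
Proof.
move=> an0; have ex_n : exists n, fcoef a n != 0.
  apply: contrapT => all0; case/eqP: an0; apply: fps_eqP => n.
  rewrite fcoef0; apply/eqP/negPn/negP => an; apply: all0; by exists n.
case: (ex_minnP ex_n) => n an minn.
exists n, (Fps (fun k => fcoef a (n + k))); rewrite /= addn0; split=> //.
apply: fpsX_divides => k; rewrite ltnNge => kn.
by apply/eqP; apply: contraNT kn; exact: minn.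
Qed.

Fact fps_integral a b : a * b = 0 -> (a == 0) || (b == 0).
Proof.
move=> ab0; case: (eqVneq a 0) => //= an0; case: (eqVneq b 0) => //= bn0.
have [m [p [p0 defa]]] := fps_order an0.
have [n [q [q0 defb]]] := fps_order bn0.
have : fcoef (a * b) (m + n) = fcoef p 0 * fcoef q 0.
  by rewrite defa defb mulrACA -exprD fcoef_XnM ltnn subnn fcoefM_0.
by rewrite ab0 fcoef0 => /esym/eqP; rewrite mulf_eq0 (negbTE p0) (negbTE q0).
Qed.

HB.instance Definition _ :=
  GRing.ComUnitRing_isIntegral.Build (fps F) fps_integral.

Lemma fpsXn_neq0 n : fpsX ^+ n != 0.
Proof.
apply/eqP => /(congr1 (fun a => fcoef a n)); rewrite -[_ ^+ n]mulr1.
by rewrite fcoef_XnM ltnn subnn fcoef0 => /eqP; rewrite oner_eq0.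
Qed.

End FpsRing.

(** * Derivations of fraction fields *)

Notation "x %:F" := (@FracField.tofrac _ x) : ring_scope.

Section FractionDerivation.
Variables (R : idomainType) (d : R -> R).
Hypothesis dD : forall x y, d (x + y) = d x + d y.
Hypothesis dM : forall x y, d (x * y) = d x * y + x * d y.

Lemma fraction_ex (t : {fraction R}) :
  exists x : R * R, x.2 != 0 /\ t = x.1%:F / x.2%:F.
Proof.
elim/quotW: t => r; exists (frac r); split; first exact: denom_ratioP.
rewrite -[RHS]/(FracField.mul _ (FracField.inv _)) !piE.
rewrite /FracField.mulf /FracField.invf
  !numden_Ratio ?oner_neq0 ?mulf_neq0 ?denom_ratioP //=.
by rewrite mulr1 mul1r Ratio_numden.
Qed.

(** The quotient rule is applied to a chosen representative; [fraction_derE] shows that the choice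
    does not matter. *)
Definition fraction_der (t : {fraction R}) : {fraction R} :=
  let x := sval (cid (fraction_ex t)) in
  (d x.1 * x.2 - x.1 * d x.2)%:F / (x.2 ^+ 2)%:F.

Lemma fraction_derE a b : b != 0 ->
  fraction_der (a%:F / b%:F) = (d a * b - a * d b)%:F / (b ^+ 2)%:F.
Proof.
move=> b0; rewrite /fraction_der; case: cid => -[n m] /= [m0 e].
have F0 x : x != 0 -> x%:F != 0 :> {fraction R} by rewrite tofrac_eq0.
have {}e : a * m = n * b.
  apply/eqP; rewrite -tofrac_eq !rmorphM; apply/eqP.
  by move/eqP: e; rewrite eqr_div ?F0 // => /eqP.
(* Two representatives satisfy a m = n b; the Leibniz rule on both sides relates their
   derivatives. *)
have de : d a * m + a * d m = d n * b + n * d b by rewrite -!dM e.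
apply/eqP; rewrite eqr_div ?F0 ?expf_neq0 // -!rmorphM tofrac_eq; apply/eqP.
have -> : (d n * m - n * d m) * b ^+ 2 =
  (d n * b + n * d b) * (m * b) - n * b * (d b * m + d m * b) by ring.
by rewrite -de -e; ring.
Qed.

Lemma fraction_der_tofrac a : fraction_der a%:F = (d a)%:F.
Proof.
have d1 : d 1 = 0.
  by have := dM 1 1; rewrite !mulr1 mul1r -[LHS]addr0 => /addrI/esym.
have := @fraction_derE a 1 (oner_neq0 _).
by rewrite d1 mulr0 subr0 mulr1 expr1n !rmorph1 !divr1.
Qed.

Lemma fraction_der_derivation : derivation fraction_der.
Proof.
have F0 x : x != 0 -> x%:F != 0 :> {fraction R} by rewrite tofrac_eq0.
split=> s t; have [[a b] /= [b0 ->]] := fraction_ex s;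
  have [[a' b'] /= [b'0 ->]] := fraction_ex t.
- have -> : a%:F / b%:F + a'%:F / b'%:F = (a * b' + a' * b)%:F / (b * b')%:F
    :> {fraction R} by rewrite rmorphM rmorphD !rmorphM addf_div ?F0.
  rewrite !fraction_derE ?mulf_neq0 // addf_div ?F0 ?expf_neq0 //.
  apply/eqP; rewrite eqr_div ?mulf_neq0 ?F0 ?expf_neq0 ?mulf_neq0 //.
  by rewrite -!(rmorphM, rmorphD) tofrac_eq !(dM, dD); apply/eqP; ring.
- have -> : a%:F / b%:F * (a'%:F / b'%:F) = (a * a')%:F / (b * b')%:F
    :> {fraction R} by rewrite !rmorphM mulf_div.
  rewrite !fraction_derE ?mulf_neq0 // !mulf_div.
  rewrite addf_div ?mulf_neq0 ?F0 ?expf_neq0 //.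
  apply/eqP; rewrite eqr_div ?mulf_neq0 ?F0 ?expf_neq0 ?mulf_neq0 //.
  by rewrite -!(rmorphM, rmorphD) tofrac_eq !(dM, dD); apply/eqP; ring.
Qed.
End FractionDerivation.

Section Derivations.
Variables (F : fieldType) (D : F -> F).
Hypothesis D_der : derivation D.

Lemma derivationD x y : D (x + y) = D x + D y. Proof. exact: D_der.1. Qed.
Lemma derivationM x y : D (x * y) = D x * y + x * D y.
Proof. exact: D_der.2. Qed.
Lemma derivation0 : D 0 = 0.
Proof.
by have := derivationD 0 0; rewrite addr0 -[LHS]addr0 => /addrI/esym.
Qed.
Lemma derivationN x : D (- x) = - D x.
Proof. by apply/eqP; rewrite -addr_eq0 -derivationD addNr derivation0. Qed.
Lemma derivationB x y : D (x - y) = D x - D y.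
Proof. by rewrite derivationD derivationN. Qed.
Lemma derivation1 : D 1 = 0.
Proof.
by have := derivationM 1 1; rewrite !mulr1 mul1r -[LHS]addr0 => /addrI/esym.
Qed.
Lemma derivation_nat n : D n%:R = 0.
Proof.
elim: n => [|n IH]; first exact: derivation0.
by rewrite -addn1 natrD derivationD IH derivation1 addr0.
Qed.
Lemma derivation_div x y : y != 0 -> D (x / y) = (D x * y - x * D y) / y ^+ 2.
Proof.
move=> y0; have : D (x / y * y) = D x by rewrite divfK.
rewrite derivationM => /(canRL (addrK _)) e.
by apply: (mulIf y0); rewrite e; field.
Qed.
Lemma derivationV x : x != 0 -> D x^-1 = - D x / x ^+ 2.
Proof.
move=> x0; rewrite -[x^-1]mul1r derivation_div //.
by rewrite derivation1 mul0r sub0r mul1r.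
Qed.

(** Riccati equations are stable under inversion, which exchanges a_0 and a_2 up to sign. A pole is
    thus traded for a zero. *)
Lemma riccati_inv (x a0 a1 a2 : F) : x != 0 ->
  D x^-1 = a2 * x^-1 ^+ 2 + a1 * x^-1 + a0 ->
  D x = - a0 * x ^+ 2 + - a1 * x + - a2.
Proof.
move=> x0; rewrite derivationV // => e.
have -> : D x = - (- D x / x ^+ 2) * x ^+ 2 by field.
by rewrite e; field.
Qed.

(** The equation is multiplied by x^4, which leaves a single factor x on the right; the order
    comparison at a pole rests on it. *)
Lemma weierstrass_inv (x alpha g2 g3 : F) : x != 0 ->
  D x^-1 ^+ 2 = alpha ^+ 2 * (4%:R * x^-1 ^+ 3 - g2 * x^-1 - g3) ->
  D x ^+ 2 = alpha ^+ 2 * (x * (4%:R - g2 * x ^+ 2 - g3 * x ^+ 3)).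
Proof.
move=> x0; rewrite derivationV // => e.
have -> : D x ^+ 2 = (- D x / x ^+ 2) ^+ 2 * x ^+ 4 by field.
by rewrite e; field.
Qed.
End Derivations.

(** * The derivation of F[[Y]] along the curve *)

Section FpsDerivation.
Variables (F : fieldType) (D : F -> F) (lam : nat -> F).
Hypothesis D_der : derivation D.
Implicit Types a b q : fps F.

Definition fps_map a := Fps (fun n => D (fcoef a n)).
Definition fps_deriv a := Fps (fun n => fcoef a n.+1 *+ n.+1).
(** Chain rule for the derivation that extends [D] and sends Y to the series z with coefficients
    [lam]. *)
Definition fps_der a := fps_map a + fps_deriv a * Fps lam.

Lemma fps_derivM a b : fps_deriv (a * b) = fps_deriv a * b + a * fps_deriv b.
Proof.
apply: fps_eqP => n; rewrite fcoefD -[LHS]/(fcoef (a * b) n.+1 *+ n.+1).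
(* The n-th coefficient of the derivative comes from the coefficient of index n + 1, hence the
   truncation at n + 2. *)
rewrite [fcoef (a * b) n.+1](@coef_fps_mul_trunc _ n.+2) //.
rewrite -coef_deriv
  derivM coefD; congr (_ + _); apply/esym/coef_fps_mul_poly => i i_n;
  rewrite ?coef_deriv -?coef_fps_trunc //; exact: leq_trans i_n _.
Qed.

Lemma fps_mapM a b : fps_map (a * b) = fps_map a * b + a * fps_map b.
Proof.
apply: fps_eqP => n; rewrite fcoefD /= -big_split.
elim/big_rec2: _ => [|i x y _ <-] /=; first exact: derivation0.
by rewrite derivationD // derivationM.
Qed.

Lemma fps_derD a b : fps_der (a + b) = fps_der a + fps_der b.
Proof.
rewrite /fps_der addrACA -mulrDl; congr (_ + _ * _); apply: fps_eqP => n.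
  by rewrite fcoefD /= derivationD.
by rewrite fcoefD /= mulrnDl.
Qed.

Lemma fps_derM a b : fps_der (a * b) = fps_der a * b + a * fps_der b.
Proof. by rewrite /fps_der fps_derivM fps_mapM; ring. Qed.

Lemma fps_der_cst x : fps_der (fps_cst x) = fps_cst (D x).
Proof.
have -> : fps_der (fps_cst x) = fps_map (fps_cst x).
  rewrite /fps_der (_ : fps_deriv _ = 0) ?mul0r ?addr0 //.
  by apply: fps_eqP => n; rewrite fcoef0 /= mul0rn.
by apply: fps_eqP => -[|n] //=; apply: derivation0.
Qed.

Lemma fps_derX : fps_der (fpsX F) = Fps lam.
Proof.
rewrite /fps_der (_ : fps_map _ = 0) ?add0r.
  rewrite (_ : fps_deriv _ = 1) ?mul1r //.
  by apply: fps_eqP => -[|n] //=; rewrite mul0rn.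
apply: fps_eqP => n; rewrite fcoef0 /=.
by case: (n == 1); [apply: derivation1 | apply: derivation0].
Qed.

Definition fps_fraction_der : {fraction (fps F)} -> {fraction (fps F)} :=
  fraction_der fps_der.
End FpsDerivation.

(** * Riccati and Weierstrass equations in the field of Laurent series *)

Section LocalSolutions.
Variables (F : fieldType) (D : F -> F) (lam : nat -> F).
Hypothesis D_der : derivation D.
Hypothesis F_char0 : [pchar F] =i pred0.
Hypotheses (lam0 : lam 0 = 0) (lam1 : lam 1 = 0).
Hypothesis lam2 : ~ has_antiderivative D (lam 2).
Implicit Types (a b q t : fps F) (x y : F).

Local Notation dP := (fps_der D lam).
Local Notation X := (fpsX F).
Local Notation cst := (@fps_cst F).

Lemma natf_neq0 n : (0 < n)%N -> n%:R != 0 :> F.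
Proof. by move/pcharf0P: F_char0 => ->; case: n. Qed.

(** In characteristic zero - n is an invertible constant, by which an antiderivative of - n lam_2
    can be divided. *)
Lemma not_antiderivativeM n x : (0 < n)%N -> D x <> - (n%:R * lam 2).
Proof.
move=> n0 Dx; apply: lam2; exists (- (x / n%:R)).
rewrite (derivationN D_der) (derivation_div D_der) ?natf_neq0 // Dx.
rewrite (derivation_nat D_der).
by field; apply: natf_neq0.
Qed.

(** The conjugate of the derivation by Y^n, sending q to (Y^n q)' / Y^n. The shifted series is Y'/Y,
    a power series as lam_0 = 0. *)
Definition fps_twist_der n q :=
  dP q + n%:R * (Fps (fun k => lam k.+1) * q).

Lemma fps_der_XnM n q : dP (X ^+ n * q) = X ^+ n * fps_twist_der n q.
Proof.
have lamE : Fps lam = X * Fps (fun k => lam k.+1).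
  by rewrite -[X]expr1; apply: (@fpsX_divides F 1) => -[|[]].
have dXn : dP (X ^+ n) = n%:R * X ^+ n * Fps (fun k => lam k.+1).
  elim: n => [|n IH].
    rewrite -[X ^+ 0](rmorph1 cst) fps_der_cst // derivation1 // rmorph0.
    by rewrite !mul0r.
  by rewrite exprS fps_derM // IH fps_derX // lamE -natr1; ring.
by rewrite fps_derM // dXn /fps_twist_der; ring.
Qed.

Lemma fcoef_natM n a k : fcoef (n%:R * a) k = n%:R * fcoef a k.
Proof. by rewrite -(rmorph_nat cst) fcoef_cstM. Qed.

Lemma fcoef_twist_der_0 n q : fcoef (fps_twist_der n q) 0 = D (fcoef q 0).
Proof.
by rewrite !fcoefD fcoef_natM !fcoefM_0 /= lam0 lam1 !(mulr0, mul0r, addr0).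
Qed.

Lemma fcoef_twist_der_1 n q :
  fcoef (fps_twist_der n q) 1 = D (fcoef q 1) + n%:R * lam 2 * fcoef q 0.
Proof.
rewrite !fcoefD fcoef_natM !fcoefM_1 /= lam0 lam1; ring.
Qed.

(** In the factor [n.+1], n comes from the twist by Y'/Y and 1 from the formal derivative of [q]. *)
Lemma fcoef_twist_der_2 n q :
  fcoef (fps_twist_der n q) 2 =
  D (fcoef q 2) + (n.+1)%:R * lam 2 * fcoef q 1 + n%:R * lam 3 * fcoef q 0.
Proof.
rewrite !fcoefD fcoef_natM !fcoefM_2 /= lam0 lam1 -natr1; ring.
Qed.

Lemma fps_subst t : t <> cst (fcoef t 0) ->
  exists n q, fcoef q 0 != 0 /\ t = cst (fcoef t 0) + X ^+ n.+1 * q.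
Proof.
move=> tc; have /fps_order[n [q [q0 e]]] : t - cst (fcoef t 0) != 0.
  by rewrite subr_eq0; apply/eqP.
have {}e : t = cst (fcoef t 0) + X ^+ n * q by rewrite -e addrC subrK.
(* Order 0 is impossible, since t minus its constant term vanishes at Y = 0. *)
case: n e => [|n] e; last by exists n, q.
have := congr1 (fun a => fcoef a 0) e; rewrite fcoefD mul1r -[LHS]addr0.
by move=> /addrI/esym q00; rewrite q00 eqxx in q0.
Qed.

Lemma riccati_fps (lam3 : ~ has_antiderivative D (lam 3)) (a0 a1 a2 : F) t :
  dP t = cst a2 * t ^+ 2 + cst a1 * t + cst a0 -> t = cst (fcoef t 0).
Proof.
move=> ode; apply: contrapT => /fps_subst[n [q [q0 e]]].
set t0 := fcoef t 0 in e.
(* These are the lower coefficients of the Riccati equation v' = a_2 v^2 + b_1 v + b_0 of v = t -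
   t_0. As v and v' vanish at Y = 0, so does b_0. *)
pose b1 := 2 * a2 * t0 + a1; pose b0 := a2 * t0 ^+ 2 + a1 * t0 + a0 - D t0.
have E : X ^+ n.+1 * fps_twist_der n.+1 q =
    X ^+ n.+1 * (X ^+ n.+1 * (cst a2 * q ^+ 2) + cst b1 * q) + cst b0.
  rewrite -fps_der_XnM /b0.
  rewrite !(rmorph_nat, rmorphD, rmorphB, rmorphM, rmorphXn) /=.
  have -> : dP (X ^+ n.+1 * q) = dP t - cst (D t0).
    by rewrite [in RHS]e fps_derD // fps_der_cst // addrAC subrr add0r.
  rewrite ode e; ring.
have b00 : b0 = 0.
  have := congr1 (fun a => fcoef a 0) E.
  by rewrite fcoefD !fcoef_XnM /= add0r.
have {E} : fps_twist_der n.+1 q = X ^+ n.+1 * (cst a2 * q ^+ 2) + cst b1 * q.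
  by apply: (mulfI (fpsXn_neq0 F n.+1)); rewrite E b00 rmorph0 addr0.
move: q0; set c := fcoef q 0 => c0 E.
have E0 : D c = b1 * c.
  have := congr1 (fun a => fcoef a 0) E.
  by rewrite fcoef_twist_der_0 fcoefD fcoef_Xn_lt // add0r fcoef_cstM.
have := congr1 (fun a => fcoef a 1) E.
rewrite fcoef_twist_der_1 fcoefD [fcoef (cst b1 * q) 1]fcoef_cstM -/c.
(* Order at least two is treated first: the term in a_2 does not reach the coefficient of Y, and the
   terms in b_1 cancel in the derivative of the quotient [fcoef q 1 / c]. *)
case: n e E => [|n] e E; last first.
  rewrite fcoef_Xn_lt // add0r => E1.
  apply: (@not_antiderivativeM n.+2 (fcoef q 1 / c)) => //.
  rewrite (derivation_div D_der) // E0 (_ : D (fcoef q 1) =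
    b1 * fcoef q 1 - n.+2%:R * lam 2 * c); last by rewrite -E1 addrK.
  by field.
rewrite (fcoef_Xn_ge 1 _ 0) fcoef_cstM expr2 fcoefM_0 -/c.
move=> /(canRL (addrK _)) E1.
have := congr1 (fun a => fcoef a 2) E.
rewrite fcoef_twist_der_2 fcoefD (fcoef_Xn_ge 1 _ 1) !fcoef_cstM expr2.
rewrite fcoefM_1 -/c.
move=> /(canRL (addrK _)) /(canRL (addrK _)) E2.
(* The witness is the coefficient of Y^2 in c / q. Indeed w = 1/(t - t_0) = Y^(-1) / q satisfies the
   linear equation w' = - b_1 w - a_2, where a_2 affects only the coefficient of Y in 1/q; at Y^2
   the factor of lam_2 is -1 + 1 = 0, and only lam_3 remains. *)
apply: lam3; exists ((fcoef q 1 / c) ^+ 2 - fcoef q 2 / c).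
rewrite (derivationB D_der) expr2 (derivationM D_der).
rewrite !(derivation_div D_der) // E2 E1 E0.
by field.
Qed.

Lemma weierstrass_fps (alpha g2 g3 : F) t :
  alpha != 0 -> D g2 = 0 -> D g3 = 0 -> 27%:R * g3 ^+ 2 - g2 ^+ 3 != 0 ->
  dP t ^+ 2 = cst (alpha ^+ 2) * (4%:R * t ^+ 3 - cst g2 * t - cst g3) ->
  t = cst (fcoef t 0).
Proof.
move=> al0 Dg2 Dg3 disc ode; apply: contrapT => /fps_subst[n [q [q0 e]]].
set t0 := fcoef t 0 in e.
(* For P(x) = 4 x^3 - g_2 x - g_3, [P0] and [P1] are the values at t_0 of P and of dP/dx. Below, [E]
   is the equation with P expanded at t_0, where P has second and third Taylor coefficients 12 t_0
   and 4. *)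
pose b := D t0; pose P0 := 4 * t0 ^+ 3 - g2 * t0 - g3.
pose P1 := 12 * t0 ^+ 2 - g2.
have dt : dP t = cst b + X ^+ n.+1 * fps_twist_der n.+1 q.
  by rewrite {1}e fps_derD // fps_der_cst // fps_der_XnM.
have E : X ^+ n.+1 * (2 * cst b * fps_twist_der n.+1 q
      + X ^+ n.+1 * fps_twist_der n.+1 q ^+ 2) + cst (b ^+ 2) =
    X ^+ n.+1 * (cst (alpha ^+ 2 * P1) * q
      + X ^+ n.+1 * (cst (alpha ^+ 2 * (12 * t0)) * q ^+ 2
        + X ^+ n.+1 * (cst (alpha ^+ 2 * 4) * q ^+ 3)))
    + cst (alpha ^+ 2 * P0).
  move: ode; rewrite dt e => ode.
  transitivity ((cst b + X ^+ n.+1 * fps_twist_der n.+1 q) ^+ 2).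
    by rewrite rmorphXn; ring.
  rewrite ode /P0 /P1 !(rmorph_nat, rmorphB, rmorphM, rmorphXn) /=; ring.
have b2 : b ^+ 2 = alpha ^+ 2 * P0.
  have := congr1 (fun a => fcoef a 0) E.
  by rewrite !fcoefD !fcoef_Xn_lt // !add0r.
have {}E : 2 * cst b * fps_twist_der n.+1 q
      + X ^+ n.+1 * fps_twist_der n.+1 q ^+ 2 =
    cst (alpha ^+ 2 * P1) * q
      + X ^+ n.+1 * (cst (alpha ^+ 2 * (12 * t0)) * q ^+ 2
        + X ^+ n.+1 * (cst (alpha ^+ 2 * 4) * q ^+ 3)).
  by apply: (mulfI (fpsXn_neq0 F n.+1)); move: E; rewrite b2 => /addIr.
have two_b (a : fps F) k : fcoef (2 * cst b * a) k = 2 * b * fcoef a k.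
  by rewrite -(rmorph_nat cst) -rmorphM fcoef_cstM.
move: q0; set c := fcoef q 0 => c0.
have E0 : 2 * b * D c = alpha ^+ 2 * P1 * c.
  have := congr1 (fun a => fcoef a 0) E.
  by rewrite !fcoefD two_b !fcoef_Xn_lt // !addr0 fcoef_cstM fcoef_twist_der_0.
have two0 : 2 != 0 :> F by apply: natf_neq0.
(* If t_0' = 0, then t_0 is a common root of P and dP/dx, which the nonzero discriminant forbids. *)
have b0 : b != 0.
  apply/eqP => b0; have P10 : P1 = 0.
    move/eqP: E0; rewrite b0 mulr0 mul0r eq_sym !mulf_eq0 (negbTE c0) orbF.
    by rewrite (negbTE al0) => /eqP.
  have P00 : P0 = 0.
    move/eqP: b2; rewrite b0 expr0n eq_sym !mulf_eq0.
    by rewrite (negbTE al0) => /eqP.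
  have g2E : g2 = 12 * t0 ^+ 2 by apply/esym/eqP; rewrite -subr_eq0 -/P1 P10.
  have g3E : g3 = 4 * t0 ^+ 3 - g2 * t0.
    by apply/esym/eqP; rewrite -subr_eq0 -/P0 P00.
  by case/eqP: disc; rewrite g3E g2E; ring.
have Dc : D c = alpha ^+ 2 * P1 * c / (2 * b).
  by rewrite -E0; field; rewrite ?two0 ?b0 ?c0 ?al0.
have DP0 : D P0 = P1 * b.
  rewrite /P0 !(derivationB D_der, derivationM D_der, exprS) expr0 Dg2 Dg3.
  rewrite !(derivation_nat D_der) -/b (derivation1 D_der) /P1; ring.
have DP1 : D P1 = 24 * t0 * b.
  rewrite /P1 !(derivationB D_der, derivationM D_der, exprS) expr0 Dg2.
  rewrite !(derivation_nat D_der) -/b (derivation1 D_der); ring.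
(* Differentiate b^2 = alpha^2 P(t_0) and divide by 2 b. *)
have Db : D b = D alpha * b / alpha + alpha ^+ 2 * P1 / 2.
  have := congr1 D b2; rewrite !expr2 !(derivationM D_der) DP0 => e1.
  apply: (mulfI (mulf_neq0 two0 b0)).
  rewrite (_ : 2 * b * D b = D b * b + b * D b); last by ring.
  rewrite e1 (_ : P0 = b ^+ 2 / alpha ^+ 2).
    by field; rewrite ?two0 ?b0 ?al0.
  by rewrite b2; field.
have := congr1 (fun a => fcoef a 1) E.
rewrite !fcoefD two_b fcoef_twist_der_1 fcoef_cstM -/c.
(* In order at least two only the terms linear in [q] reach the coefficient of Y, and
   [fcoef q 1 / c] has derivative - n lam_2, n being the order, as in the Riccati case. *)
case: n e dt E => [|n] _ _ _; last first.
  rewrite !fcoef_Xn_lt // !addr0 => E1.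
  apply: (@not_antiderivativeM n.+2 (fcoef q 1 / c)) => //.
  rewrite (derivation_div D_der) // Dc (_ : D (fcoef q 1) =
    alpha ^+ 2 * P1 * fcoef q 1 / (2 * b) - n.+2%:R * lam 2 * c).
    by field; rewrite ?two0 ?b0 ?c0 ?al0.
  by rewrite -E1; field; rewrite ?two0 ?b0 ?c0 ?al0.
rewrite !(fcoef_Xn_ge 1 _ 0) fcoefD fcoef_Xn_lt // addr0 fcoef_cstM.
rewrite !expr2 !fcoefM_0 fcoef_twist_der_0 -/c => E1.
have De : D (fcoef q 1) = (alpha ^+ 2 * P1 * fcoef q 1
    + alpha ^+ 2 * (12 * t0) * (c * c) - D c * D c) / (2 * b) - lam 2 * c.
  by rewrite -E1; field; rewrite ?two0 ?b0.
(* The witness is the quotient of the first two coefficients of the elliptic *)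
(* integral of dx/sqrt(P(x)) from t_0 to t.                                  *)
have four0 : 4 != 0 :> F by apply: natf_neq0.
apply: (@not_antiderivativeM 1
  (fcoef q 1 / c - alpha * alpha * P1 * c / (4 * b * b))) => //.
rewrite (derivationB D_der) !(derivation_div D_der) ?mulf_neq0 //.
rewrite !(derivationM D_der) DP1 De Dc (derivation_nat D_der) Db.
by field; rewrite ?two0 ?b0 ?c0 ?al0 ?four0.
Qed.

(** If [a] has order m > 0, the left side has order at least 2m. The right side has order exactly m
    unless alpha = 0, because the bracket has constant term 4. *)
Lemma weierstrass_pole_fps (alpha g2 g3 : F) a :
  a != 0 -> fcoef a 0 = 0 ->
  dP a ^+ 2 =
    cst (alpha ^+ 2) * (a * (4%:R - cst g2 * a ^+ 2 - cst g3 * a ^+ 3)) ->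
  alpha = 0.
Proof.
move=> /fps_order[[|n] [q [q0 ->]]] a0 ode.
  by move: a0; rewrite mul1r => a0; rewrite a0 eqxx in q0.
move: ode; rewrite fps_der_XnM; set u := 4 - _ - _ => ode.
have {}ode : X ^+ n.+1 * fps_twist_der n.+1 q ^+ 2 = cst (alpha ^+ 2) * (q * u).
  apply: (mulfI (fpsXn_neq0 F n.+1)).
  by transitivity ((X ^+ n.+1 * fps_twist_der n.+1 q) ^+ 2);
    [ring | rewrite ode; ring].
have u0 : fcoef u 0 = 4.
  have z k : fcoef ((X ^+ n.+1 * q) ^+ k.+1) 0 = 0.
    by rewrite exprS -mulrA; apply: fcoef_Xn_lt.
  by rewrite /u !fcoefB !fcoef_cstM !z -(rmorph_nat cst) !mulr0 !subr0.
have /eqP := congr1 (fun a => fcoef a 0) ode.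
rewrite fcoef_Xn_lt // fcoef_cstM fcoefM_0 u0 eq_sym !mulf_eq0.
by rewrite (negbTE q0) (negbTE (natf_neq0 _)) // !orbF orbb => /eqP.
Qed.

Local Notation LF := {fraction (fps F)}.
Local Notation dL := (fps_fraction_der D lam).

Definition fps_frac_cst : F -> LF := fun x => (cst x)%:F.
HB.instance Definition _ := GRing.RMorphism.copy fps_frac_cst
  (@FracField.tofrac (fps F) \o cst).

Lemma tofrac_Xn_div m n p q : (n <= m)%N -> fcoef q 0 != 0 ->
  (X ^+ m * p)%:F / (X ^+ n * q)%:F = (X ^+ (m - n) * (p * q^-1))%:F :> LF.
Proof.
move=> nm q0; have Vq : q^-1 * q = 1 by apply: mulVr.
have bq0 : X ^+ n * q != 0.
  rewrite mulf_neq0 ?fpsXn_neq0 //.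
  by apply: contraNneq q0 => ->; rewrite fcoef0.
apply: (canLR (mulfK _)); first by rewrite tofrac_eq0.
by rewrite -rmorphM mulrACA -exprD subnK // -mulrA Vq mulr1.
Qed.

(** F[[Y]] is a valuation ring: compare the orders of numerator and denominator. *)
Lemma fps_fraction_cases (s : LF) :
  (exists a, s = a%:F) \/ (exists a, [/\ a != 0, fcoef a 0 = 0 & s = a%:F^-1]).
Proof.
have [[a b] /= [b0 ->]] := fraction_ex s.
case: (eqVneq a 0) => [->|a0]; first by left; exists 0; rewrite rmorph0 mul0r.
have [m [p [p0 defa]]] := fps_order a0; have [n [q [q0 defb]]] := fps_order b0.
case: (leqP n m) => [nm | mn]; [left | right].
  by rewrite defa defb tofrac_Xn_div //; exists (X ^+ (m - n) * (p * q^-1)).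
exists (X ^+ (n - m) * (q * p^-1)); split.
- rewrite -tofrac_eq0 -tofrac_Xn_div ?(ltnW mn) // -defa -defb.
  by rewrite mulf_neq0 ?invr_eq0 ?tofrac_eq0.
- by rewrite fcoef_Xn_lt ?subn_gt0.
by rewrite -tofrac_Xn_div ?(ltnW mn) // -defa -defb invf_div.
Qed.

Let dL_der : derivation dL.
Proof.
exact: (fraction_der_derivation (fps_derD lam D_der) (fps_derM lam D_der)).
Qed.

Lemma fps_fraction_der_tofrac a : dL a%:F = (dP a)%:F.
Proof. exact: (fraction_der_tofrac (fps_derM lam D_der)). Qed.

Lemma fps_fraction_der_cst x : dL (fps_frac_cst x) = fps_frac_cst (D x).
Proof. by rewrite fps_fraction_der_tofrac fps_der_cst. Qed.

Lemma riccati_fps_fraction (lam3 : ~ has_antiderivative D (lam 3))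
    (a0 a1 a2 : F) (s : LF) :
  dL s = fps_frac_cst a2 * s ^+ 2 + fps_frac_cst a1 * s + fps_frac_cst a0 ->
  exists x, s = fps_frac_cst x.
Proof.
have [[a ->]|[a [an0 a0e ->]]] := fps_fraction_cases s.
  rewrite fps_fraction_der_tofrac /fps_frac_cst.
  rewrite -!(rmorphM, rmorphXn, rmorphD) => /eqP; rewrite tofrac_eq => /eqP.
  move=> /(riccati_fps lam3) ->.
  by exists (fcoef a 0).
(* At a pole, the inverse series solves the reversed equation, so it is constant; vanishing at Y =
   0, it would be zero. *)
have aF : a%:F != 0 :> LF by rewrite tofrac_eq0.
move=> /(riccati_inv dL_der aF) e; rewrite fps_fraction_der_tofrac in e.
move/eqP: e; rewrite /fps_frac_cst -!rmorphN.
rewrite -!(rmorphM, rmorphXn, rmorphD) tofrac_eq => /eqP.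
move/(riccati_fps lam3); rewrite a0e rmorph0 => a00.
by rewrite a00 eqxx in an0.
Qed.

(** A constant solves the Riccati equation with all coefficients zero. *)
Lemma constant_fps_fraction (lam3 : ~ has_antiderivative D (lam 3)) (s : LF) :
  dL s = 0 -> exists2 x, D x = 0 & s = fps_frac_cst x.
Proof.
move=> ds; have [x sx] : exists x, s = fps_frac_cst x.
  apply: (@riccati_fps_fraction lam3 0 0 0).
  by rewrite rmorph0 !mul0r !addr0.
exists x => //; move: ds; rewrite sx fps_fraction_der_cst => /eqP.
by rewrite fmorph_eq0 => /eqP.
Qed.

Lemma weierstrass_fps_fraction (alpha g2 g3 : F) (s : LF) :
  alpha != 0 -> D g2 = 0 -> D g3 = 0 -> 27%:R * g3 ^+ 2 - g2 ^+ 3 != 0 ->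
  dL s ^+ 2 = fps_frac_cst alpha ^+ 2
    * (4%:R * s ^+ 3 - fps_frac_cst g2 * s - fps_frac_cst g3) ->
  exists x, s = fps_frac_cst x.
Proof.
move=> al0 Dg2 Dg3 disc.
have [[a ->]|[a [an0 a0e ->]]] := fps_fraction_cases s.
  rewrite fps_fraction_der_tofrac /fps_frac_cst.
  rewrite -!(rmorph_nat (@FracField.tofrac _)).
  rewrite -!(rmorphM, rmorphXn, rmorphB) => /eqP.
  rewrite tofrac_eq => /eqP /(weierstrass_fps al0 Dg2 Dg3 disc) ->.
  by exists (fcoef a 0).
have aF : a%:F != 0 :> LF by rewrite tofrac_eq0.
move=> /(weierstrass_inv dL_der aF) e; rewrite fps_fraction_der_tofrac in e.
move: e; rewrite /fps_frac_cst -!(rmorph_nat (@FracField.tofrac _)).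
rewrite -!(rmorphM, rmorphXn, rmorphB) => /eqP; rewrite tofrac_eq => /eqP.
move/(weierstrass_pole_fps an0 a0e) => alpha0.
by rewrite alpha0 eqxx in al0.
Qed.
End LocalSolutions.

(** * The curve at the origin and its function field *)

Section BivariateEvaluation.
Variables (F : fieldType) (R : comNzRingType).
Variables (i : {rmorphism F -> R}) (y z : R).

(** The formula of [eval_ext], with values in any nonzero commutative ring so that F[[Y]] is allowed
    as a target. *)
Definition biv_eval (g : {poly {poly F}}) : R :=
  (map_poly (map_poly i) g).[z%:P].[y].

Fact biv_eval_is_zmod_morphism : zmod_morphism biv_eval.
Proof. by move=> g h; rewrite /biv_eval rmorphB !hornerE. Qed.
HB.instance Definition _ := GRing.isZmodMorphism.Build _ _ biv_eval
  biv_eval_is_zmod_morphism.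
Fact biv_eval_is_monoid_morphism : monoid_morphism biv_eval.
Proof. by split=> [|g h]; rewrite /biv_eval ?rmorph1 ?rmorphM !hornerE. Qed.
HB.instance Definition _ := GRing.isMonoidMorphism.Build _ _ biv_eval
  biv_eval_is_monoid_morphism.

Lemma biv_evalC p : biv_eval p%:P = (map_poly i p).[y].
Proof. by rewrite /biv_eval map_polyC hornerC. Qed.
Lemma biv_evalX : biv_eval 'X = z.
Proof. by rewrite /biv_eval map_polyX hornerX hornerC. Qed.
Lemma biv_evalY : biv_eval 'X%:P = y.
Proof. by rewrite biv_evalC map_polyX hornerX. Qed.
Lemma biv_eval_XsubC p : biv_eval ('X - p%:P) = z - (map_poly i p).[y].
Proof. by rewrite rmorphB /= biv_evalX biv_evalC. Qed.
End BivariateEvaluation.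

Lemma rmorph_biv_eval (F : fieldType) (R S : comNzRingType)
    (i : {rmorphism F -> R}) (j : {rmorphism F -> S}) (phi : {rmorphism R -> S})
    (y z : R) g : phi \o i =1 j ->
  phi (biv_eval i y z g) = biv_eval j (phi y) (phi z) g.
Proof.
move=> ij; rewrite /biv_eval -!horner_map /= map_polyC -map_poly_comp.
congr (_.[_].[_]); apply: eq_map_poly => p /=.
by rewrite -map_poly_comp; apply: eq_map_poly.
Qed.

Section CurveAtOrigin.
Variable F : fieldType.
Implicit Types (f g : {poly {poly F}}).

Lemma eval_biv00 g : eval_biv g 0 0 = g`_0`_0.
Proof. by rewrite /eval_biv !horner_coef0. Qed.
Lemma partialY00 g : eval_biv (partialY g) 0 0 = g`_0`_1.
Proof. by rewrite eval_biv00 coef_map coef_deriv. Qed.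
Lemma partialZ00 g : eval_biv (partialZ g) 0 0 = g`_1`_0.
Proof. by rewrite eval_biv00 coef_deriv. Qed.

(** The point (1,0) lies on the tangent, which kills the Y-partial at the origin; simplicity then
    makes the Z-partial nonzero. *)
Lemma horizontal_tangent f : simple_point f (0, 0) ->
  tangent_line f (0, 0) = [set Q | Q.2 = 0] ->
  [/\ f`_0`_0 = 0, f`_0`_1 = 0 & f`_1`_0 != 0].
Proof.
rewrite /simple_point /= partialY00 partialZ00 eval_biv00 => -[f00 f10] tan.
have f01 : f`_0`_1 = 0.
  have : tangent_line f (0, 0) (1, 0) by rewrite tan.
  by rewrite /tangent_line /= partialY00 !subr0 mulr1 mulr0 addr0.
by split=> //; case: f10; rewrite ?f01 ?eqxx.
Qed.

Section Expansion.
Variables (f : {poly {poly F}}) (lam : nat -> F).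
Hypotheses (f00 : f`_0`_0 = 0) (f01 : f`_0`_1 = 0) (f10 : f`_1`_0 != 0).
Hypothesis lam_exp : Yadic_expansion f 'X lam.

Lemma size_f_gt1 : (1 < size f)%N.
Proof.
by rewrite ltnNge; apply: contra f10 => /(nth_default 0) ->; rewrite coef0.
Qed.

(** Putting Z = 0 leaves an identity in F[Y]. Since f(Y,0) has order at least 2, its first two
    coefficients give lam_0 = lam_1 = 0. *)
Let coefZ0 (s g h : {poly {poly F}}) n (p : {poly F}) :
  s * ('X - p%:P) = g * 'X%:P ^+ n.+1 + h * f ->
  - (s`_0 * p) = g`_0 * 'X ^+ n.+1 + h`_0 * f`_0.
Proof.
move=> /(congr1 (fun u : {poly {poly F}} => u`_0)).
rewrite coefD !coef0M coefB coefX coefC /= sub0r mulrN.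
by rewrite -rmorphXn coefC.
Qed.

Lemma expansion_coef0 : lam 0 = 0.
Proof.
have [s [g [h [s0 /coefZ0]]]] := lam_exp 0.
move=> /(congr1 (fun u : {poly F} => u`_0)).
rewrite coefN coefD !coef0M f00 mulr0 addr0 expr1 coefX mulr0 coef_poly /=.
by move=> /eqP; rewrite oppr_eq0 mulf_eq0 -eval_biv00 (negbTE s0) => /eqP.
Qed.

Lemma expansion_coef1 : lam 1 = 0.
Proof.
have [s [g [h [s0 /coefZ0]]]] := lam_exp 1.
move=> /(congr1 (fun u : {poly F} => u`_1)).
rewrite coefN coefD !coefM !big_ord_recr !big_ord0 /= !coef_poly !coefXn /=.
rewrite f00 f01 expansion_coef0 !(mulr0, add0r, addr0).
by move=> /eqP; rewrite oppr_eq0 mulf_eq0 -eval_biv00 (negbTE s0) => /eqP.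
Qed.

Lemma fcoef_poly_eval (p : {poly F}) n :
  fcoef (map_poly (@fps_cst F) p).[fpsX F] n = p`_n.
Proof.
elim/poly_ind: p n => [|p c IH] n.
  by rewrite rmorph0 horner0 coef0 fcoef0.
rewrite rmorphD rmorphM /= map_polyX map_polyC !hornerE fcoefD mulrC.
rewrite -[fpsX F]expr1 fcoef_XnM coefD coefMX coefC.
by case: n => [|n] /=; rewrite ?subn1 ?IH ?add0r ?addr0.
Qed.

Local Notation evP := (biv_eval (@fps_cst F) (fpsX F) (Fps lam)).

Lemma biv_eval_fps_coef0 g : fcoef (evP g) 0 = g`_0`_0.
Proof.
rewrite -[LHS]/(fcoef_at0 (evP g)) (@rmorph_biv_eval _ _ _ _ idfun) //.
rewrite -eval_biv00 /biv_eval /eval_biv map_poly_id => [|p _].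
  by rewrite /fcoef_at0 /= expansion_coef0.
by rewrite map_poly_id.
Qed.

(** Evaluating the congruence of order n at (Y, z) shows that Y^(n+1) divides h f, where h becomes a
    unit of F[[Y]]. So every coefficient of f(Y, z) vanishes. *)
Lemma fps_on_curve : evP f = 0.
Proof.
apply: fps_eqP => n; rewrite fcoef0.
have [s [g [h [s0 e]]]] := lam_exp n.
(* Comparing the coefficients of Y^0 Z^1 gives s(0,0) = h(0,0) f_Z(0,0). *)
have h0 : fcoef (evP h) 0 != 0.
  have := congr1 (fun u : {poly {poly F}} => u`_1`_0) e.
  rewrite /= coefD !coefM !big_ord_recr !big_ord0 /= -rmorphXn !coefB !coefX.
  rewrite !coefC /= subr0 sub0r mulr0 addr0 add0r mulr1.
  rewrite !coefD !coef0M coefN coef_poly /= expansion_coef0 f00 coefXn.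
  rewrite !(oppr0, mulr0, addr0, add0r) => sh.
  rewrite biv_eval_fps_coef0; apply: contraNneq s0 => h0.
  by rewrite eval_biv00 sh h0 mul0r coef0 !addr0.
have pE k : (k < n.+1)%N -> (\poly_(i < n.+1) lam i)`_k = lam k.
  by rewrite coef_poly => ->.
move: (\poly_(i < n.+1) lam i) pE e => p pE e.
have lamE : evP ('X - p%:P)
    = fpsX F ^+ n.+1 * Fps (fun k => fcoef (evP ('X - p%:P)) (n.+1 + k)).
  apply: fpsX_divides => k kn.
  have -> : evP ('X - p%:P) = Fps lam - (map_poly (@fps_cst F) p).[fpsX F].
    exact: biv_eval_XsubC.
  by rewrite fcoefB fcoef_poly_eval pE // subrr.
have := congr1 evP e; rewrite rmorphD !rmorphM rmorphXn /= biv_evalY lamE.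
rewrite mulrCA (mulrC (evP g)) => /esym /(canRL (addKr _)).
rewrite -mulrN -mulrDr; move: (- _ + _) => w hf.
have -> : evP f = fpsX F ^+ n.+1 * ((evP h)^-1 * w).
  by rewrite mulrCA -hf mulKr.
by rewrite fcoef_Xn_lt.
Qed.
End Expansion.
End CurveAtOrigin.

(** * Embeddings of function fields, finiteness and transport of derivations *)

Lemma quotient_rmorphism (A : comNzRingType) (E L : fieldType)
    (e1 : {rmorphism A -> E}) (e2 : {rmorphism A -> L}) :
  (forall a, e1 a = 0 <-> e2 a = 0) ->
  (forall x, exists a b, e1 b != 0 /\ x = e1 a / e1 b) ->
  exists phi : {rmorphism E -> L}, forall a, phi (e1 a) = e2 a.
Proof.
move=> ker quo.
have quo2 x : exists ab : A * A, e1 ab.2 != 0 /\ x = e1 ab.1 / e1 ab.2.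
  by have [a [b ab]] := quo x; exists (a, b).
pose phi x := let ab := sval (cid (quo2 x)) in e2 ab.1 / e2 ab.2.
have e2_neq0 b : e1 b != 0 -> e2 b != 0.
  by apply: contraNneq => /ker ->.
have phiE a b : e1 b != 0 -> phi (e1 a / e1 b) = e2 a / e2 b.
  move=> b0; rewrite /phi; case: cid => -[a' b'] /= [b'0 /eqP].
  rewrite eqr_div // -!rmorphM -subr_eq0 -rmorphB => /eqP/ker/eqP.
  rewrite rmorphB !rmorphM subr_eq0 => /eqP e.
  by apply/eqP; rewrite eqr_div ?e2_neq0 // e.
have phi_e1 a : phi (e1 a) = e2 a.
  by have := @phiE a 1; rewrite !rmorph1 !divr1 => -> //; apply: oner_neq0.
have phiB : zmod_morphism phi.
  move=> x y; have [[a b] /= [b0 ->]] := quo2 x.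
  have [[a' b'] /= [b'0 ->]] := quo2 y.
  rewrite !phiE // -!mulNr !addf_div ?e2_neq0 //.
  rewrite -!rmorphN -!(rmorphM, rmorphD) phiE //.
  by rewrite rmorphM mulf_neq0.
have phiM : monoid_morphism phi.
  split=> [|x y]; first by rewrite -(rmorph1 e1) phi_e1 rmorph1.
  have [[a b] /= [b0 ->]] := quo2 x; have [[a' b'] /= [b'0 ->]] := quo2 y.
  rewrite !phiE // !mulf_div -!rmorphM phiE //.
  by rewrite rmorphM mulf_neq0.
pose phi_morph : {rmorphism E -> L} := HB.pack phi
  (GRing.isZmodMorphism.Build _ _ phi phiB)
  (GRing.isMonoidMorphism.Build _ _ phi phiM).
by exists phi_morph.
Qed.

(* Bezout over F[Y]: if f does not divide g then u f + v g is a nonzero       *)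
(* element of F[Y], at which e2 does not vanish.                              *)
Lemma curve_kernel (F : fieldType) (f : {poly {poly F}}) (K R : idomainType)
    (e1 : {rmorphism {poly {poly F}} -> K})
    (e2 : {rmorphism {poly {poly F}} -> R}) :
  (1 < size f)%N -> (forall g, e1 g = 0 <-> exists h, g = h * f) ->
  e2 f = 0 -> (forall p, e2 p%:P = 0 -> p = 0) ->
  forall g, e1 g = 0 <-> e2 g = 0.
Proof.
move=> f1 ker e2f e2C g.
split=> [/ker[h ->]|e2g]; first by rewrite rmorphM e2f mulr0.
apply: contrapT => /eqP e1g.
have f0 : f != 0 by apply: contraTneq f1 => ->; rewrite size_poly0.
have e1f : e1 f = 0 by apply/ker; exists 1; rewrite mul1r.
have e1C p : p != 0 -> e1 p%:P != 0.
  move=> p0; apply/eqP => /ker[h e].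
  have : size (p%:P : {poly {poly F}}) == 1 by rewrite size_polyC p0.
  by rewrite e size_mul_eq1 => /andP[_ /eqP f_1]; rewrite f_1 in f1.
have e1Z p h : p != 0 -> e1 (p *: h) = 0 -> e1 h = 0.
  move=> p0 /eqP; rewrite -mul_polyC rmorphM mulf_eq0 (negbTE (e1C _ p0)).
  by move=> /eqP.
(* Let d be the gcd and c f = q d. As [e1] takes values in a domain, either d is in its kernel, and
   then so is g, or f divides q, and then d divides c and has degree 0 in Z. *)
have cop : coprimep f g.
  have /Pdiv.Idomain.dvdpP[[c q] /= c0 e] := dvdp_gcdl f g.
  have /Pdiv.Idomain.dvdpP[[c' q'] /= c'0 e'] := dvdp_gcdr f g.
  set d := gcdp f g in e e'.
  have /eqP : e1 (q * d) = 0 by rewrite -e -mul_polyC rmorphM e1f mulr0.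
  rewrite rmorphM mulf_eq0 => /orP[]/eqP; last first.
    move=> d0; case/eqP: e1g; apply: (e1Z _ _ c'0).
    by rewrite e' rmorphM d0 mulr0.
  move/ker=> [w defq]; move: e; rewrite defq -mulrA mulrCA -mul_polyC.
  rewrite mulrC => /(mulfI f0) cwd.
  have : size (c%:P : {poly {poly F}}) == 1 by rewrite size_polyC c0.
  by rewrite cwd size_mul_eq1 => /andP[].
have /Pdiv.Idomain.Bezout_coprimepP[[u v]] := cop.
move=> /= /eqpP[[c c'] /= /andP[c0 c'0] e].
have := congr1 e2 e; rewrite -!mul_polyC rmorphM rmorphD !rmorphM e2f e2g.
rewrite !mulr0 addr0 mulr0 rmorph1 mulr1 => /esym/e2C c'e.
by rewrite c'e eqxx in c'0.
Qed.

(** With m generators, the coordinate rows of the m + 1 powers y^0, ..., y^m are linearly dependent;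
    a dependency is a nonzero polynomial that vanishes at y. *)
Lemma transcendental_not_finite (F E : fieldType) (j : {rmorphism F -> E})
    (y : E) :
  (forall p : {poly F}, (map_poly j p).[y] = 0 -> p = 0) ->
  ~ finite_over (range j).
Proof.
move=> tr [s fin].
have fin' (k : 'I_(size s).+1) : exists a : 'I_(size s) -> F,
    y ^+ k = \sum_(i < size s) j (a i) * s`_i.
  have [c cj ->] := fin (y ^+ k).
  exists (fun i => sval (cid2 (cj i))); apply: eq_bigr => i _.
  by case: cid2 => x /= _ ->.
pose A := \matrix_(k < (size s).+1, i < size s) sval (cid (fin' k)) i.
have kA : kermx A != 0.
  rewrite kermx_eq0; apply/negP => /eqP rA.
  by have := rank_leq_col A; rewrite rA ltnn.
have uA : nz_row (kermx A) *m A = 0 by apply/sub_kermxP/nz_row_sub.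
set u := nz_row _ in uA; have /eqP[] : u != 0 by rewrite nz_row_eq0.
rewrite -[u]rVpolyK (tr (rVpoly u)) ?linear0 //.
rewrite (@horner_coef_wide _ (size s).+1); last first.
  exact: leq_trans (size_poly _ _) (size_poly _ _).
rewrite (eq_bigr (fun k : 'I_(size s).+1 =>
  \sum_(i < size s) j (u 0 k * A k i) * s`_i)) => [|k _].
  rewrite exchange_big /= big1 // => i _.
  rewrite -mulr_suml -rmorph_sum /=.
  have := congr1 (fun B : 'rV_(size s) => B 0 i) uA.
  by rewrite !mxE => ->; rewrite rmorph0 mul0r.
rewrite coef_map coef_rVpoly_ord /= (svalP (cid (fin' k))) mulr_sumr.
by apply: eq_bigr => i _; rewrite mxE rmorphM mulrA.
Qed.

Lemma finite_over_gen_subfield (E : fieldType) (A S : set E) :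
  subfield_set S -> A `<=` S -> finite_over (gen_subfield A) -> finite_over S.
Proof.
move=> sS AS [s fin]; exists s => x; have [c cA ->] := fin x.
by exists c => // i; apply: smallest_sub (cA i).
Qed.

Lemma range_subfield_set (F E : fieldType) (j : {rmorphism F -> E}) :
  subfield_set (range j).
Proof.
split; first by exists 1; rewrite ?rmorph1.
- by move=> _ _ [x _ <-] [y _ <-]; exists (x - y); rewrite ?rmorphB.
- by move=> _ _ [x _ <-] [y _ <-]; exists (x / y); rewrite ?fmorph_div.
Qed.

(** The minimal polynomial has coefficients in F and splits there, so x is one of its roots in F.
    Hence [Ft] may be replaced by F throughout. *)
Lemma closed_field_extension (F : closedFieldType) (L : fieldExtType F)
    (x : L) :
  exists a : F, x = a%:A.
Proof.
have /polyOver1P[p minE] : minPoly 1 x \is a polyOver 1%VS.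
  by apply: minPolyOver.
have p0 : p != 0.
  apply: contraTneq (monic_minPoly 1 x) => p0.
  by rewrite minE p0 rmorph0 monicE lead_coef0 eq_sym oner_eq0.
have [r pr] := closed_field_poly_normal p.
have := root_minPoly 1 x; rewrite minE pr map_polyZ rootZ; last first.
  by rewrite fmorph_eq0 lead_coef_eq0.
rewrite rmorph_prod /= (eq_bigr (fun a => 'X - a%:A%:P)) => [|a _]; last first.
  by rewrite rmorphB /= map_polyX map_polyC.
rewrite /root horner_prod prodf_seq_eq0 => /hasP[a _ /=].
by rewrite hornerXsubC subr_eq0 => /eqP; exists a.
Qed.

Lemma quotient_subfield_set (A : comNzRingType) (E : fieldType)
    (e : {rmorphism A -> E}) :
  subfield_set [set x | exists a b, e b != 0 /\ x = e a / e b].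
Proof.
split.
- by exists 1, 1; rewrite rmorph1 divr1 oner_neq0.
- move=> _ _ [a [b [b0 ->]]] [a' [b' [b'0 ->]]].
  exists (a * b' - a' * b), (b * b'); rewrite rmorphM mulf_neq0 //; split=> //.
  by rewrite rmorphB !rmorphM -[in LHS]mulNr addf_div // mulNr.
- move=> _ _ [a [b [b0 ->]]] [a' [b' [b'0 ->]]].
  (* Closure under division includes division by 0, whose value is 0. *)
  have [a'0|a'0] := eqVneq (e a') 0.
    exists 0, 1; rewrite a'0 mul0r invr0 mulr0 rmorph0 rmorph1 mul0r.
    by rewrite oner_neq0.
  exists (a * b'), (b * a'); rewrite rmorphM mulf_neq0 //; split=> //.
  by rewrite !rmorphM invf_div mulf_div.
Qed.

Section DerivationTransport.
Variables (F E L : fieldType) (dE : E -> E) (dL : L -> L).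
Hypotheses (dE_der : derivation dE) (dL_der : derivation dL).
Variables (j : {rmorphism F -> E}) (phi : {rmorphism E -> L}) (y z : E).
Hypothesis phi_cst : forall a, phi (dE (j a)) = dL (phi (j a)).
Hypothesis phi_y : phi (dE y) = dL (phi y).
Local Notation ev := (biv_eval j y z).

(** The failure of [phi] to commute with the derivations is itself a derivation along [phi], so it
    is determined by its values on the coefficients, y and z. *)
Let delta x := dL (phi x) - phi (dE x).

Let deltaD x x' : delta (x + x') = delta x + delta x'.
Proof.
rewrite /delta (derivationD dE_der) !rmorphD (derivationD dL_der).
by rewrite opprD addrACA.
Qed.

Let deltaM x x' : delta (x * x') = delta x * phi x' + phi x * delta x'.
Proof.
rewrite /delta (derivationM dE_der) !(rmorphD, rmorphM) (derivationM dL_der).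
by rewrite mulrBl mulrBr opprD addrACA.
Qed.

Let delta_cst a : delta (j a) = 0.
Proof. by rewrite /delta phi_cst subrr. Qed.

Let delta_y : delta y = 0.
Proof. by rewrite /delta phi_y subrr. Qed.

Let delta0 : delta 0 = 0.
Proof. by rewrite -(rmorph0 j) delta_cst. Qed.

Let delta_polyC p : delta (ev p%:P) = 0.
Proof.
rewrite biv_evalC; elim/poly_ind: p => [|p c IH].
  by rewrite rmorph0 horner0 delta0.
rewrite rmorphD rmorphM /= map_polyX map_polyC !hornerE deltaD deltaM.
by rewrite IH delta_cst delta_y mul0r mulr0 !addr0.
Qed.

(** Chain rule; the Y-partial drops out because [delta] vanishes at y. *)
Let delta_eval g : delta (ev g) = phi (ev g^`()) * delta z.
Proof.
elim/poly_ind: g => [|g c IH].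
  by rewrite deriv0 !rmorph0 mul0r delta0.
rewrite derivD derivM derivX derivC mulr1 addr0.
rewrite !(rmorphD ev) !(rmorphM ev) /= biv_evalX.
rewrite deltaD deltaM IH delta_polyC addr0.
by rewrite rmorphD rmorphM mulrDl mulrAC.
Qed.

(* The relation f(y,z) = 0 determines the derivative of z from those of the   *)
(* coefficients and of y, because z is a simple root.                         *)
Lemma derivation_transport f : ev f = 0 -> ev f^`() != 0 ->
  (forall x, exists a b, ev b != 0 /\ x = ev a / ev b) ->
  forall x, phi (dE x) = dL (phi x).
Proof.
move=> evf evf' quo x.
have delta_z : delta z = 0.
  have /eqP := delta_eval f; rewrite evf delta0 eq_sym mulf_eq0 fmorph_eq0.
  by rewrite (negbTE evf') => /eqP.
have delta_ev g : delta (ev g) = 0 by rewrite delta_eval delta_z mulr0.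
have [a [b [b0 ->]]] := quo x.
have : delta (ev a / ev b * ev b) = 0 by rewrite divfK.
rewrite deltaM delta_ev mulr0 addr0 => /eqP.
by rewrite mulf_eq0 fmorph_eq0 (negbTE b0) orbF subr_eq0 => /eqP.
Qed.
End DerivationTransport.

(** * Exclusion of the algebraic, Riccati and Weierstrass types *)

Section MainArgument.
Variables (F : closedFieldType) (D : F -> F).
Variables (f : {poly {poly F}}) (lam : nat -> F).
Hypothesis D_der : derivation D.
Hypothesis F_char0 : [pchar F] =i pred0.
Hypotheses (f00 : f`_0`_0 = 0) (f01 : f`_0`_1 = 0) (f10 : f`_1`_0 != 0).
Hypothesis lam_exp : Yadic_expansion f 'X lam.
Hypotheses (lam2 : ~ has_antiderivative D (lam 2))
  (lam3 : ~ has_antiderivative D (lam 3)).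

Local Notation LF := {fraction (fps F)}.
Local Notation dL := (fps_fraction_der D lam).
Local Notation cL := (@fps_frac_cst F : {rmorphism F -> LF}).
Local Notation Y := ((fpsX F)%:F : LF).

Let dL_der : derivation dL.
Proof.
exact: (fraction_der_derivation (fps_derD lam D_der) (fps_derM lam D_der)).
Qed.

Let lam0 : lam 0 = 0 := expansion_coef0 f00 lam_exp.
Let lam1 : lam 1 = 0 := expansion_coef1 f00 f01 lam_exp.

Let dL_Y : dL Y = (Fps lam)%:F.
Proof. by rewrite fps_fraction_der_tofrac // fps_derX. Qed.

Let evL g : biv_eval cL Y (Fps lam)%:F g
  = (biv_eval (@fps_cst F) (fpsX F) (Fps lam) g)%:F.
Proof.
by rewrite (@rmorph_biv_eval _ _ _ _ cL (@FracField.tofrac (fps F))).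
Qed.

(** Transcendence of Y over F, in the form required by [curve_kernel]. *)
Let evL_polyC p : biv_eval cL Y (Fps lam)%:F p%:P = 0 -> p = 0.
Proof.
rewrite evL => /eqP; rewrite tofrac_eq0 biv_evalC => /eqP p0.
by apply/polyP => n; rewrite -fcoef_poly_eval p0 fcoef0 coef0.
Qed.

Let evL_f : biv_eval cL Y (Fps lam)%:F f = 0.
Proof. by rewrite evL fps_on_curve // rmorph0. Qed.

Lemma not_algebraic_type : ~ algebraic_type D f.
Proof.
move=> /(_ LF dL cL Y)[].
  split.
  - by split=> // x; rewrite fps_fraction_der_cst.
  - move=> c /(constant_fps_fraction D_der F_char0 lam0 lam1 lam2 lam3).
    by case=> x Dx ->; exists x.
  - by rewrite dL_Y; exact: evL_f.
move=> p p0 /eqP; rewrite -[LHS](@biv_evalC _ _ cL _ (Fps lam)%:F).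
by move=> /evL_polyC; apply/eqP.
Qed.

Section Embedding.
Variables (Ft : fieldExtType F) (E : fieldType) (dE : E -> E).
Variable jt : {rmorphism Ft -> E}.
Hypothesis comp : is_compositum D f dE jt.

(** As [Ft] reduces to F, E consists of the quotients of polynomials in y and z. The maps from
    F[Y,Z] to E and to the Laurent series have the same kernel, the multiples of f, so y and z can
    be sent to Y and its derivative. *)
Lemma compositum_embedding :
  exists phi : {rmorphism E -> LF},
    [/\ forall a : F, phi (jt a%:A) = cL a,
        forall a : F, dE (jt a%:A) = jt (D a)%:A,
        forall x, phi (dE x) = dL (phi x)
      & exists y, phi y = Y].
Proof.
have [dT [K [dK [i [y [z [jK [Kf dTF [dET dEK] jiK gen]]]]]]]] := comp.
have [dKF dKy ker quoK] := Kf.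
have dE_der : derivation dE := dET.1.
pose e1 : {rmorphism {poly {poly F}} -> E} :=
  biv_eval (jt \o in_alg Ft) (jK y) (jK z).
have jK_ev g : jK (biv_eval i y z g) = e1 g.
  by apply: rmorph_biv_eval => a; rewrite /= jiK.
have e1_ker g : e1 g = 0 <-> exists h, g = h * f.
  rewrite -ker -jK_ev; split=> [/eqP|gK].
    by rewrite fmorph_eq0 => /eqP.
  by rewrite [biv_eval _ _ _ _]gK rmorph0.
have e1C c : e1 c%:P%:P = jt c%:A.
  by rewrite [LHS]biv_evalC map_polyC hornerC.
have e1X : e1 'X = jK z by exact: biv_evalX.
have e1Y : e1 'X%:P = jK y by exact: biv_evalY.
have e1_quo x : exists a b, e1 b != 0 /\ x = e1 a / e1 b.
  move: x; have: setT `<=` [set x | exists a b, e1 b != 0 /\ x = e1 a / e1 b].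
    rewrite -gen; apply: smallest_sub.
      exact: (quotient_subfield_set e1).
    move=> x [[u _ <-]|[u _ <-]].
      have [a ->] := closed_field_extension u.
      by exists a%:P%:P, 1; rewrite (rmorph1 e1) divr1 oner_neq0 e1C.
    have [g [h [h0 ->]]] := quoK u; exists g, h.
    by rewrite -!jK_ev fmorph_eq0 fmorph_div.
  by move=> sub x; apply: sub.
have phi_ex : exists phi : {rmorphism E -> LF},
    forall g, phi (e1 g) = biv_eval cL Y (Fps lam)%:F g.
  apply: quotient_rmorphism => //.
  by apply: (@curve_kernel _ f) => //; first exact: size_f_gt1.
have [phi phiE] := phi_ex.
have phi_cst a : phi (jt a%:A) = cL a.
  by rewrite -e1C phiE biv_evalC map_polyC hornerC.
have dE_cst a : dE (jt a%:A) = jt (D a)%:A.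
  by rewrite dET.2; congr (jt _); apply: dTF.2.
have phi_y : phi (jK y) = Y.
  by rewrite -[jK y]e1Y phiE biv_evalY.
have phi_z : phi (jK z) = (Fps lam)%:F.
  by rewrite -[jK z]e1X phiE biv_evalX.
exists phi; split=> //; last by exists (jK y).
apply: (derivation_transport dE_der dL_der _ _ (f := f)) e1_quo.
- by move=> a; rewrite /= dE_cst !phi_cst fps_fraction_der_cst.
- by rewrite dEK.2 dKy phi_z phi_y dL_Y.
- by apply/e1_ker; exists 1; rewrite mul1r.
(* The Z-partial of f takes on the curve a value with constant term f_Z(0,0), which is nonzero. *)
rewrite -(fmorph_eq0 phi) phiE evL tofrac_eq0; apply: contraNneq f10 => f'0.
rewrite -[f`_1]mulr1n -coef_deriv -(@biv_eval_fps_coef0 _ f lam) //.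
by rewrite f'0 fcoef0.
Qed.

Lemma compositum_not_finite : ~ finite_over (range (jt \o in_alg Ft)).
Proof.
have [phi [phi_cst _ _ [y phi_y]]] := compositum_embedding.
apply: (@transcendental_not_finite _ _ _ y) => p py.
apply: evL_polyC; rewrite biv_evalC -phi_y.
rewrite -(_ : map_poly phi (map_poly (jt \o in_alg Ft) p) = map_poly cL p).
  by rewrite horner_map py rmorph0.
by rewrite -map_poly_comp; apply: eq_map_poly => a; apply: phi_cst.
Qed.

(** Generators in F generate no more than F, over which E is not finite. This excludes both types
    once t is known to lie in F. *)
Lemma not_finite_over_constants (A : set E) :
  A `<=` range (jt \o in_alg Ft) ->
  ~ finite_over (gen_subfield (range jt `|` A)).
Proof.
move=> sA.
move=> /(finite_over_gen_subfield (range_subfield_set (jt \o in_alg Ft))) fin.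
apply/compositum_not_finite/fin => x [[u _ <-]|/sA//].
by have [a ->] := closed_field_extension u; exists a.
Qed.
End Embedding.

Lemma not_Riccati_type : ~ Riccati_type D f.
Proof.
case=> _ [Ft [E [dE [jt [t [a0 [a1 [a2 [comp fin ode _]]]]]]]]].
have [phi [phi_cst dE_cst phi_dE _]] := compositum_embedding comp.
have [[b0 e0] [b1 e1] [b2 e2]] := And3 (closed_field_extension a0)
  (closed_field_extension a1) (closed_field_extension a2).
have [x tx] : exists x, phi t = cL x.
  apply: (riccati_fps_fraction D_der F_char0 lam0 lam1 lam2 lam3
    (a0 := b0) (a1 := b1) (a2 := b2)).
  by rewrite -phi_dE ode e0 e1 e2 !(rmorphD, rmorphM, rmorphXn) !phi_cst.
apply: (not_finite_over_constants comp) fin => _ ->.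
by exists x => //; apply: (fmorph_inj phi); rewrite /= phi_cst.
Qed.

Lemma not_Weierstrass_type : ~ Weierstrass_type D f.
Proof.
case=> _ [Ft [E [dE [jt [t [g2 [g3 [alpha [comp fin [Dg2 Dg3] ode disc]]]]]]]]].
have [phi [phi_cst dE_cst phi_dE _]] := compositum_embedding comp.
have [al e] := closed_field_extension alpha.
have [x tx] : exists x, phi t = cL x.
  (* The definition allows alpha = 0; then t is a constant, and its image lies in F as well. *)
  have [al0|al0] := eqVneq al 0.
    have [|x _ tx] := constant_fps_fraction D_der F_char0 lam0 lam1 lam2 lam3
      (s := phi t); last by exists x.
    have dt : dE t = 0.
      by apply/eqP; rewrite -sqrf_eq0 ode e al0 scale0r rmorph0 expr0n mul0r.
    by rewrite -phi_dE dt rmorph0.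
  apply: (weierstrass_fps_fraction D_der F_char0 lam0 lam1 lam2
    al0 Dg2 Dg3 disc).
  rewrite -phi_dE -rmorphXn ode e !(rmorphB, rmorphM, rmorphXn) !phi_cst.
  by rewrite rmorph_nat.
have {}tx : t = jt x%:A by apply: (fmorph_inj phi); rewrite tx phi_cst.
apply: (not_finite_over_constants comp) fin => _ [->|->].
  by exists x.
by exists (D x) => //; rewrite tx dE_cst.
Qed.
End MainArgument.

Theorem theorem7p1
    (k : fieldType) (d : k -> k)
    (k_char0 : [pchar k] =i pred0)
    (d_der : derivation d)
    (C_closed : closed_constants d)
    (kbar : closedFieldType) (iota : {rmorphism k -> kbar})
    (kbar_alg : forall x : kbar, algebraicOver iota x)
    (D : kbar -> kbar) (D_ext : diff_ext d D iota)
    (f : {poly {poly kbar}})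
    (f_irr : irreducible_biv f)
    (p_simple : simple_point f (0, 0))
    (p_tangent : tangent_line f (0, 0) = [set Q | Q.2 = 0])
    (lam : nat -> kbar)
    (lam_exp : Yadic_expansion f 'X lam)
    (lam2 : ~ has_antiderivative D (lam 2%N))
    (lam3 : ~ has_antiderivative D (lam 3%N)) :
  general_type D f.
Proof.
have [f00 f01 f10] := horizontal_tangent p_simple p_tangent.
have D_der : derivation D := D_ext.1.
have kbar_char0 : [pchar kbar] =i pred0.
  by move=> p; rewrite (fmorph_pchar iota) k_char0.
split.

- exact: (not_algebraic_type D_der kbar_char0 f00 f01 lam_exp lam2 lam3).
- exact: (not_Riccati_type D_der kbar_char0 f00 f01 f10 lam_exp lam2 lam3).
- exact: (not_Weierstrass_type D_der kbar_char0 f00 f01 f10 lam_exp lam2 lam3).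
Qed.
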